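(* Let $d\ge 2$. For all $p,r\in[1,\infty]$, $$C_{p,p,r}=\max\left\{2^{1/p},\,2^{1-1/p},\,2^{1-1/r}\right\}.$$
   Context: For a complex $d\times d$ matrix $X$ with singular values $\sigma_1\ge\dots\ge\sigma_d\ge 0$, the Schatten $p$-norm is $\|X\|_p=(\sigma_1^p+\cdots+\sigma_d^p)^{1/p}$ for $1\le p<\infty$, and $\|X\|_\infty=\sigma_1$. Convention: $1/\infty=0$. For $p,q,r\in[1,\infty]$, $C_{p,q,r}$ denotes the smallest constant $C$ such that $\|XY-YX\|_p\le C\,\|X\|_q\,\|Y\|_r$ for all complex $d\times d$ matrices $X,Y$. *)

(* Defs.v *)
From HB Require Import structures.
From mathcomp Require Import all_boot all_order all_algebra.
From mathcomp Require Import spectral.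
From mathcomp Require Import complex.
From mathcomp Require Import all_classical all_reals all_analysis.

Set Implicit Arguments.
Unset Strict Implicit.
Unset Printing Implicit Defensive.

Import Order.TTheory GRing.Theory Num.Theory.
Local Open Scope ring_scope.
Local Open Scope complex_scope.
Local Open Scope sesquilinear_scope.
Local Open Scope classical_set_scope.

Section Schatten.
Variables (R : realType) (d : nat).
Implicit Types (X Y : 'M[R[i]]_d) (p q r : \bar R).

(* [X^t* *m X] is normal, so [spectral_diag] lists its eigenvalues with
   multiplicity; these are nonnegative reals, hence [complex.Re] loses nothing. *)
Definition singular_values X : seq R :=
  sort (fun x y => y <= x)
    [seq Num.sqrt (complex.Re (spectral_diag (X^t* *m X) 0 i)) | i : 'I_d].

(* Only exponents [1 <= p] are meaningful; the value at [-oo] is junk. *)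
Definition schatten p X : R :=
  match p with
  | a%:E => (\sum_(s <- singular_values X) s `^ a) `^ a^-1
  | +oo%E => head 0 (singular_values X)
  | -oo%E => 0
  end.

Definition commutator_bounds p q r : set R :=
  [set C | forall X Y, schatten p (X *m Y - Y *m X)
                       <= C * schatten q X * schatten r Y].

Definition is_commutator_constant p q r (C : R) : Prop :=
  commutator_bounds p q r C /\ lbound (commutator_bounds p q r) C.

End Schatten.

Arguments is_commutator_constant {R} d p q r C.

(* [inve] sends [+oo] to [0], which is the convention [1/oo = 0]. *)
Definition recip (R : realType) (p : \bar R) : R := fine (p^-1)%E.

(* Main.v *)
Require Import Defs.
From mathcomp Require Import all_boot all_order all_algebra.
From mathcomp Require Import spectral sesquilinear.
From mathcomp Require Import cyclic separable cyclotomic complex.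
From mathcomp Require Import all_classical all_reals all_analysis.
From mathcomp Require Import ring lra.

(* Put e = 1/p, z = 1/r and t = min(z, e, 1 - e); the constant is 2^(1 - t).
   Writing X, Y and a norming functional Z of [X, Y] through their singular
   value decompositions turns tr([X, Y] Z) into a trilinear form in the singular
   values.  The point (e, t) is a convex combination of (0, 0), (1, 0) and
   (1/2, 1/2); the bound is trivial (constant 2) at the first two, and it is the
   Boettcher-Wenzel inequality (constant sqrt 2) at the third, proved through
   Audenaert's variance bound.  Riesz-Thorin interpolation between the three is
   replaced by a power trick: the coefficients of the n-th power of the form in
   independent phases are extracted with roots of unity and bounded at the three
   points at once, their number is polynomial in n, and n tends to infinity.
   Lower bounds: the matrices E12, E21 and E11 - E22. *)

Set Implicit Arguments.
Unset Strict Implicit.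
Unset Printing Implicit Defensive.

Import Order.TTheory GRing.Theory Num.Theory.
Local Open Scope ring_scope.
Local Open Scope sesquilinear_scope.

(** * Frobenius norm, contractions and the Boettcher-Wenzel inequality *)

Section Frobenius.
Variable C : numClosedFieldType.

Definition frob2 m n (A : 'M[C]_(m, n)) : C := \tr (A *m A^t*).

Lemma adjmxM m n p (A : 'M[C]_(m, n)) (B : 'M[C]_(n, p)) :
  (A *m B)^t* = B^t* *m A^t*.
Proof. by rewrite trmx_mul map_mxM. Qed.

Lemma adjmxD m n (A B : 'M[C]_(m, n)) : (A + B)^t* = A^t* + B^t*.
Proof. by rewrite linearD map_mxD. Qed.

Lemma adjmxB m n (A B : 'M[C]_(m, n)) : (A - B)^t* = A^t* - B^t*.
Proof. by rewrite linearB map_mxB. Qed.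

Lemma frob2E m n (A : 'M[C]_(m, n)) : frob2 A = \sum_i \sum_j `|A i j| ^+ 2.
Proof.
apply: eq_bigr => i _; rewrite mxE; apply: eq_bigr => j _.
by rewrite !mxE normCK.
Qed.

Lemma frob2_ge0 m n (A : 'M[C]_(m, n)) : 0 <= frob2 A.
Proof.
by rewrite frob2E; apply: sumr_ge0 => i _; apply: sumr_ge0 => j _; rewrite exprn_ge0.
Qed.

Lemma frob2_adj m n (A : 'M[C]_(m, n)) : frob2 (A^t*) = frob2 A.
Proof.
rewrite !frob2E exchange_big; apply: eq_bigr => i _.
by apply: eq_bigr => j _; rewrite !mxE norm_conjC.
Qed.

(** The trace of D times the adjoint of E is the dot product of the vectorised D and E. *)
Lemma mxtrace_CauchySchwarz m n (A : 'M[C]_(m, n)) (B : 'M[C]_(n, m)) :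
  `|\tr (A *m B)| ^+ 2 <= frob2 A * frob2 B.
Proof.
have trE (D E : 'M[C]_(m, n)) : \tr (D *m E^t*) = dotmx (mxvec D) (mxvec E).
  rewrite dotmxE mxE (reindex _ (curry_mxvec_bij _ _)) /=.
  transitivity (\sum_i \sum_j D i j * (E^t*) j i).
    by apply: eq_bigr => i _; rewrite mxE.
  by rewrite pair_bigA; apply: eq_bigr => -[i j] _; rewrite !mxE !mxvecE.
rewrite -(trmxCK B) (frob2_adj (B^t*)) /frob2 !trE.
by have [] := CauchySchwarz (@dotmx C _) (mxvec A) (mxvec (B^t*)).
Qed.

(** Operator norm at most 1, phrased through the Frobenius norm: the columns of N are the test
    vectors. *)
Definition contraction_mx n (M : 'M[C]_n) :=
  forall N : 'M[C]_n, frob2 (M *m N) <= frob2 N.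

Lemma contractionM n (A B : 'M[C]_n) :
  contraction_mx A -> contraction_mx B -> contraction_mx (A *m B).
Proof. by move=> cA cB N; rewrite -mulmxA (le_trans (cA _)). Qed.

(** With F the left-hand side, cyclicity and Cauchy-Schwarz give F^2 <= F * frob2 N, and F
    cancels. *)
Lemma contraction_adj n (A : 'M[C]_n) : contraction_mx A -> contraction_mx (A^t*).
Proof.
move=> cA N; set F := frob2 _.
have F0 : 0 <= F by exact: frob2_ge0.
have [->|F_neq0] := eqVneq F 0; first exact: frob2_ge0.
have F_gt0 : 0 < F by rewrite lt_def F_neq0.
rewrite -(ler_pM2l F_gt0) -expr2.
have {1}-> : F = `|\tr (A *m (A^t* *m N) *m N^t*)|.
  rewrite -(ger0_norm F0) /F /frob2 adjmxM trmxCK mxtrace_mulC.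
  by rewrite -[X in \tr X]mulmxA mxtrace_mulC.
apply: le_trans (mxtrace_CauchySchwarz _ _) _.
by rewrite frob2_adj ler_wpM2r ?frob2_ge0.
Qed.

Lemma contraction_mulr n (A N : 'M[C]_n) :
  contraction_mx A -> frob2 (N *m A) <= frob2 N.
Proof.
move=> /contraction_adj cA.
by rewrite -frob2_adj adjmxM (le_trans (cA _)) ?frob2_adj.
Qed.

Lemma contraction_unitary n (U : 'M[C]_n) : U \is unitarymx -> contraction_mx U.
Proof.
move=> Uu N; rewrite /frob2 adjmxM mxtrace_mulC mulmxA.
by rewrite mulmxKtV // mxtrace_mulC.
Qed.

Lemma frob2_diag_mull n (u : 'rV[C]_n) (N : 'M[C]_n) :
  frob2 (diag_mx u *m N) = \sum_i \sum_j `|u 0 i| ^+ 2 * `|N i j| ^+ 2.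
Proof.
rewrite frob2E; apply: eq_bigr => i _; apply: eq_bigr => j _.
by rewrite mul_diag_mx mxE normrM exprMn.
Qed.

Lemma frob2_diag n (u : 'rV[C]_n) : frob2 (diag_mx u) = \sum_i `|u 0 i| ^+ 2.
Proof.
rewrite frob2E; apply: eq_bigr => i _; rewrite (bigD1 i) //= big1 ?addr0.
  by rewrite mxE eqxx.
by move=> j ji; rewrite mxE eq_sym (negPf ji) normr0 expr0n.
Qed.

Lemma contraction_diag n (u : 'rV[C]_n) :
  (forall i, `|u 0 i| <= 1) -> contraction_mx (diag_mx u).
Proof.
move=> u1 N; rewrite frob2_diag_mull frob2E.
apply: ler_sum => i _; apply: ler_sum => j _.
by rewrite ler_piMl ?exprn_ge0 ?exprn_ile1.
Qed.

Lemma contraction_partial_isometry n (U : 'M[C]_n) (e : 'rV[C]_n) :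
  (forall i, (e 0 i == 0) || (e 0 i == 1)) ->
  U^t* *m U = diag_mx e -> contraction_mx U.
Proof.
move=> e01 UU N.
have -> : frob2 (U *m N) = \tr (N^t* *m (diag_mx e *m N)).
  by rewrite /frob2 adjmxM mxtrace_mulC -UU !mulmxA.
rewrite mxtrace_mulC frob2E; apply: ler_sum => i _.
rewrite -mulmxA mul_diag_mx !mxE mulr_sumr; apply: ler_sum => j _.
rewrite !mxE -normCK; have /orP[/eqP->|/eqP->] := e01 i; last by rewrite mul1r.
by rewrite mul0r exprn_ge0.
Qed.

Lemma contraction_entry n (M : 'M[C]_n) k : contraction_mx M -> `|M k k| <= 1.
Proof.
move=> /(_ (delta_mx k k)) cM.
have frobE (A : 'M[C]_n) :
    frob2 (A *m delta_mx k k) = \sum_i `|A i k| ^+ 2.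
  rewrite frob2E; apply: eq_bigr => i _; rewrite (bigD1 k) //= big1 ?addr0.
    rewrite mxE (bigD1 k) //= big1 ?addr0 ?mxE ?eqxx ?mulr1 //.
    by move=> l lk; rewrite !mxE (negPf lk) mulr0.
  move=> j jk; rewrite mxE big1 ?normr0 ?expr0n // => l _.
  by rewrite mxE (negPf jk) andbF mulr0.
move: cM; rewrite -[delta_mx k k in X in _ <= X]mul1mx !frobE.
have -> : \sum_i `|(1%:M : 'M[C]_n) i k| ^+ 2 = 1.
  rewrite (bigD1 k) //= big1 ?addr0 ?mxE ?eqxx ?normr1 ?expr1n //.
  by move=> l lk; rewrite mxE (negPf lk) normr0 expr0n.
rewrite (bigD1 k) //= => cM; rewrite -(@expr_le1 _ 2) //.
by apply: le_trans cM; rewrite lerDl sumr_ge0 // => i _; rewrite exprn_ge0.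
Qed.

(** Cyclicity brings the trace to the diagonal of the contraction [H *m M *m G] weighted by u: the
    duality of trace norm and operator norm. *)
Lemma mxtrace_contraction n (M G H : 'M[C]_n) (u : 'rV[C]_n) :
  contraction_mx M -> contraction_mx G -> contraction_mx H ->
  `|\tr (M *m (G *m diag_mx u *m H))| <= \sum_i `|u 0 i|.
Proof.
move=> cM cG cH; rewrite mulmxA mxtrace_mulC !mulmxA.
rewrite mul_mx_diag /mxtrace.
have cHMG := contractionM (contractionM cH cM) cG.
apply: le_trans (ler_norm_sum _ _ _) _; apply: ler_sum => i _.
by rewrite mxE normrM ler_piMl // contraction_entry.
Qed.

(** * Unitary invariance and the Boettcher-Wenzel inequality *)

Lemma frob2_unitaryl n (U A : 'M[C]_n) :
  U \is unitarymx -> frob2 (U *m A) = frob2 A.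
Proof.
move=> Uu; rewrite /frob2 adjmxM mxtrace_mulC mulmxA mulmxKtV //.
exact: mxtrace_mulC.
Qed.

Lemma frob2_unitaryr n (U A : 'M[C]_n) :
  U \is unitarymx -> frob2 (A *m U) = frob2 A.
Proof.
move=> Uu; rewrite -frob2_adj adjmxM frob2_unitaryl ?frob2_adj //.
by rewrite trmxC_unitary.
Qed.

(** The mixed terms of the two squares on the left cancel by cyclicity; the remaining four traces
    factor. *)
Lemma frob2_comm_anticomm n (X Y : 'M[C]_n) :
  frob2 (X *m Y - Y *m X) + frob2 (X^t* *m Y + Y *m X^t*) =
  \tr ((X^t* *m X + X *m X^t*) *m (Y *m Y^t* + Y^t* *m Y)).
Proof.
rewrite /frob2 adjmxB adjmxD !adjmxM trmxCK.
have trN (A : 'M[C]_n) : \tr (- A) = - \tr A by exact: raddfN.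
rewrite !(mulmxDl, mulmxDr, mulNmx, mulmxN, opprK) !(mxtraceD, trN).
have cyc (A B D E : 'M[C]_n) : \tr (A *m B *m (D *m E)) = \tr (B *m D *m (E *m A)).
  by rewrite -mulmxA mxtrace_mulC !mulmxA.
rewrite (cyc X Y (Y^t*)) (cyc Y X (X^t*)) (cyc (X^t*) Y (Y^t*)).
rewrite (cyc (X^t*) Y X) (cyc Y (X^t*) X).
rewrite (mxtrace_mulC (Y *m Y^t*) (X^t* *m X)) (mxtrace_mulC (Y *m Y^t*)).
rewrite (cyc Y (X^t*) (Y^t*)) (mxtrace_mulC (X^t* *m Y^t*)).
ring.
Qed.

(* Expanding [sum_ij w_i w_j |x_i + x_j|^2] and keeping only its diagonal terms
   reduces the claim to [W w_i - w_i^2 <= W^2 / 4]. *)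
Lemma weighted_variance_le n (w x : 'I_n -> C) (W := \sum_i w i) :
  (forall i, 0 <= w i) ->
  W * (\sum_i w i * `|x i| ^+ 2) - `|\sum_i w i * x i| ^+ 2 <=
  W ^+ 2 / 2 * \sum_i `|x i| ^+ 2.
Proof.
move=> w_ge0.
have wC i : (w i)^* = w i by exact/CrealP/ger0_real.
have key : \sum_i w i ^+ 2 * (4 * `|x i| ^+ 2) <=
    2 * (W * \sum_i w i * `|x i| ^+ 2) + 2 * `|\sum_i w i * x i| ^+ 2.
  have -> : 2 * (W * \sum_i w i * `|x i| ^+ 2) + 2 * `|\sum_i w i * x i| ^+ 2 =
      \sum_i \sum_j w i * w j * `|x i + x j| ^+ 2.
    have -> : \sum_i \sum_j w i * w j * `|x i + x j| ^+ 2 =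
      \sum_i \sum_j ((w i * `|x i| ^+ 2) * w j + w i * (w j * `|x j| ^+ 2) +
        (w i * x i) * (w j * x j)^* + (w i * x i)^* * (w j * x j)).
      apply: eq_bigr => i _; apply: eq_bigr => j _.
      by rewrite !normCK !rmorphM /= !rmorphD /= !wC; ring.
    have dist (f g : 'I_n -> C) :
        \sum_(p : 'I_n * 'I_n) f p.1 * g p.2 = (\sum_i f i) * (\sum_j g j).
      rewrite mulr_suml -(pair_bigA _ (fun i j => f i * g j)).
      by apply: eq_bigr => i _; rewrite mulr_sumr.
    rewrite pair_bigA !big_split /= (dist (fun i => w i * `|x i| ^+ 2) w).
    rewrite (dist w (fun i => w i * `|x i| ^+ 2)).
    rewrite (dist (fun i => w i * x i) (fun i => (w i * x i)^*)).
    rewrite (dist (fun i => (w i * x i)^*) (fun i => w i * x i)).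
    rewrite -!rmorph_sum normCK -/W; ring.
  apply: ler_sum => i _; rewrite (bigD1 i) //=.
  have -> : `|x i + x i| ^+ 2 = 4 * `|x i| ^+ 2.
    by rewrite -mulr2n normrMn; ring.
  by rewrite -expr2 lerDl; apply: sumr_ge0 => j _; rewrite !mulr_ge0 ?exprn_ge0.
have quad : \sum_i 2 * `|x i| ^+ 2 * (W * w i - w i ^+ 2) <=
    W ^+ 2 / 2 * \sum_i `|x i| ^+ 2.
  rewrite mulr_sumr; apply: ler_sum => i _.
  have -> : W ^+ 2 / 2 * `|x i| ^+ 2 =
      2 * `|x i| ^+ 2 * (W * w i - w i ^+ 2) + (W / 2 - w i) ^+ 2 * 2 * `|x i| ^+ 2.
    by field.
  have sq_ge0 : 0 <= (W / 2 - w i) ^+ 2.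
    apply: real_exprn_even_ge0 => //.
    by rewrite rpredB ?ger0_real // divr_ge0 // sumr_ge0.
  by rewrite lerDl; do 2?[apply: mulr_ge0] => //; rewrite exprn_ge0.
apply: le_trans quad.
set A := W * _; set B := `|_| ^+ 2; rewrite -subr_ge0.
have -> : \sum_i 2 * `|x i| ^+ 2 * (W * w i - w i ^+ 2) - (A - B) =
    (2 * A + 2 * B - \sum_i w i ^+ 2 * (4 * `|x i| ^+ 2)) / 2.
  have -> : \sum_i 2 * `|x i| ^+ 2 * (W * w i - w i ^+ 2) =
      2 * A - (\sum_i w i ^+ 2 * (4 * `|x i| ^+ 2)) / 2.
    rewrite /A !(mulr_sumr, mulr_suml) -sumrB.
    by apply: eq_bigr => i _; field.
  by field.
by apply: divr_ge0 => //; rewrite subr_ge0.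
Qed.

(** The preceding identity reads F + G = T, and Cauchy-Schwarz against [Y^t*] gives |tau|^2 <= G S.
    Hence S F <= S T - |tau|^2, which splits into a variance term for the diagonal of X and
    off-diagonal terms. *)
Lemma BoettcherWenzel_diag n (X Y : 'M[C]_n) (w : 'rV[C]_n) :
  Y *m Y^t* + Y^t* *m Y = diag_mx w ->
  frob2 (X *m Y - Y *m X) <= 2 * frob2 X * frob2 Y.
Proof.
move=> YYw; move ES: (frob2 Y) => S.
have S_ge0 : 0 <= S by rewrite -ES frob2_ge0.
have w_ge0 i : 0 <= w 0 i.
  have /matrixP/(_ i i) := YYw; rewrite !mxE eqxx mulr1n => <-.
  by apply: addr_ge0; apply: sumr_ge0 => j _;
    rewrite !mxE ?mul_conjC_ge0 // mulrC mul_conjC_ge0.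
have sum_w : \sum_i w 0 i = 2 * S.
  have <- : \tr (diag_mx w) = \sum_i w 0 i.
    by apply: eq_bigr => i _; rewrite mxE eqxx.
  by rewrite -YYw mxtraceD [X in _ + X]mxtrace_mulC -ES /frob2; ring.
set F := frob2 (_ - _); set G := frob2 (X^t* *m Y + Y *m X^t*).
set T := \sum_i \sum_j `|X i j| ^+ 2 * (w 0 i + w 0 j).
have FG : F + G = T.
  rewrite frob2_comm_anticomm YYw mulmxDl mxtraceD.
  have trD (A : 'M[C]_n) :
      \tr (A *m A^t* *m diag_mx w) = \sum_i \sum_j `|A i j| ^+ 2 * w 0 i.
    rewrite mul_mx_diag; apply: eq_bigr => i _; rewrite !mxE mulr_suml.
    by apply: eq_bigr => j _; rewrite !mxE normCK.
  have := trD (X^t*); rewrite trmxCK => ->; rewrite trD exchange_big -big_split.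
  apply: eq_bigr => i _; rewrite -big_split; apply: eq_bigr => j _ /=.
  by rewrite !mxE norm_conjC; ring.
set tau := \sum_i w 0 i * X i i.
have CS : `|tau| ^+ 2 <= G * S.
  have -> : `|tau| = `|\tr ((X^t* *m Y + Y *m X^t*) *m Y^t*)|.
    rewrite mulmxDl mxtraceD -!mulmxA [X in _ + X]mxtrace_mulC -mulmxA.
    rewrite -mxtraceD -mulmxDr YYw mul_mx_diag -norm_conjC rmorph_sum.
    congr `|_|; apply: eq_bigr => i _.
    by rewrite !mxE rmorphM /= mulrC (CrealP (ger0_real (w_ge0 i))).
  by rewrite (le_trans (mxtrace_CauchySchwarz _ _)) // frob2_adj ES.
have [S0|S_neq0] := eqVneq S 0.
  have w0 i : w 0 i = 0.
    move/eqP: sum_w; rewrite S0 mulr0 psumr_eq0 // => /allP/(_ i).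
    by rewrite mem_index_enum => /(_ isT)/eqP.
  have T0 : T = 0.
    rewrite /T big1 // => i _; rewrite big1 // => j _.
    by rewrite !w0 addr0 mulr0.
  by rewrite S0 mulr0 -T0 -FG lerDl frob2_ge0.
have S_gt0 : 0 < S by rewrite lt_def S_neq0.
rewrite -(ler_pM2l S_gt0).
have -> : S * F = S * T - S * G by rewrite -FG; ring.
have var : S * T - `|tau| ^+ 2 <= S * (2 * frob2 X * S).
  have := weighted_variance_le (fun i => X i i) w_ge0; rewrite sum_w -/tau.
  (* Off the diagonal, w i + w j is at most the total weight 2 S because i and j differ; the
     diagonal is left to the variance bound. *)
  have Tle : S * T <= 2 * S * (\sum_i w 0 i * `|X i i| ^+ 2) +
     S * (2 * S * (frob2 X - \sum_i `|X i i| ^+ 2)).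
    rewrite frob2E /T !mulr_sumr -sumrB !mulr_sumr -big_split.
    apply: ler_sum => i _ /=.
    rewrite (bigD1 i) //= [in X in _ <= X](bigD1 i) //= addrAC subrr add0r.
    have -> : 2 * S * (w 0 i * `|X i i| ^+ 2) = S * (`|X i i| ^+ 2 * (w 0 i + w 0 i)).
      by ring.
    rewrite mulrDr lerD2l ler_pM2l // mulr_sumr; apply: ler_sum => j ji.
    rewrite mulrC ler_wpM2r ?exprn_ge0 // -sum_w (bigD1 i) //= (bigD1 j) //=.
    by rewrite addrA lerDl sumr_ge0.
  move=> V; rewrite lerBlDr (le_trans Tle) //.
  rewrite -subr_ge0 in V; rewrite -subr_ge0; apply: le_trans V _.
  by rewrite le_eqVlt; apply/orP; left; apply/eqP; field.
by apply: le_trans var; rewrite lerD2l lerN2 mulrC.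
Qed.

(** A unitary P diagonalises the Hermitian matrix H; conjugation by P respects commutators and
    Frobenius norms. *)
Theorem BoettcherWenzel n (X Y : 'M[C]_n) :
  frob2 (X *m Y - Y *m X) <= 2 * frob2 X * frob2 Y.
Proof.
set H := Y *m Y^t* + Y^t* *m Y.
have Hn : H \is normalmx.
  have HH : H^t* = H by rewrite /H adjmxD !adjmxM !trmxCK.
  by apply/normalmxP; rewrite HH.
have /orthomx_spectralP := Hn.
set P := spectralmx H; set w := spectral_diag H => Hdiag.
have Pu : P \is unitarymx by exact: spectral_unitarymx.
have PtP : P^t* *m P = 1%:M by rewrite -invmx_unitary // mulVmx // unitarymx_unit.
have PPt : P *m P^t* = 1%:M by apply/unitarymxP.
pose X' := P *m X *m P^t*; pose Y' := P *m Y *m P^t*.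
have conjM (A B : 'M[C]_n) :
    (P *m A *m P^t*) *m (P *m B *m P^t*) = P *m (A *m B) *m P^t*.
  by rewrite !mulmxA -[X in X *m B]mulmxA PtP mulmx1.
have Pt_u : P^t* \is unitarymx by rewrite trmxC_unitary.
have YYw : Y' *m Y'^t* + Y'^t* *m Y' = diag_mx w.
  rewrite /Y' !adjmxM trmxCK !(mulmxA P) !conjM -mulmxDl -mulmxDr -/H Hdiag.
  by rewrite invmx_unitary // !mulmxA PPt mul1mx -mulmxA PPt mulmx1.
have := @BoettcherWenzel_diag _ X' Y' _ YYw.
rewrite /X' /Y' !conjM -mulmxBl -mulmxBr.
by rewrite !(frob2_unitaryr _ Pt_u) !(frob2_unitaryl _ Pu).
Qed.

(** * The trilinear commutator form and its three endpoint bounds *)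

Lemma frob2_sandwich_le n (G H : 'M[C]_n) (u : 'rV[C]_n) :
  contraction_mx G -> contraction_mx H ->
  frob2 (G *m diag_mx u *m H) <= \sum_i `|u 0 i| ^+ 2.
Proof.
by move=> cG cH; rewrite (le_trans (contraction_mulr _ cH)) // -frob2_diag.
Qed.

(** The outer factors stay fixed while the diagonals vary, so that interpolation acts on singular
    values alone. *)
Definition commutator_form n (G H : 'I_3 -> 'M[C]_n) (x y z : 'rV[C]_n) : C :=
  let X := G 0 *m diag_mx x *m H 0 in
  let Y := G 1 *m diag_mx y *m H 1 in
  let Z := G 2 *m diag_mx z *m H 2 in
  \tr ((X *m Y - Y *m X) *m Z).

Section CommutatorForm.
Variables (n : nat) (G H : 'I_3 -> 'M[C]_n).
Hypotheses (cG : forall a, contraction_mx (G a)) (cH : forall a, contraction_mx (H a)).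
Implicit Types x y z : 'rV[C]_n.

Let contraction_sandwich a x : (forall i, `|x 0 i| <= 1) ->
  contraction_mx (G a *m diag_mx x *m H a).
Proof.
by move=> x1; apply: contractionM => //; apply: contractionM => //;
  apply: contraction_diag.
Qed.

(** The endpoint (e, t) = (0, 0): X and Y are contractions, and each of the two products pairs a
    contraction with Z. *)
Lemma commutator_form_le_sum3 x y z :
  (forall i, `|x 0 i| <= 1) -> (forall i, `|y 0 i| <= 1) ->
  `|commutator_form G H x y z| <= 2 * \sum_i `|z 0 i|.
Proof.
move=> /(contraction_sandwich 0) cX /(contraction_sandwich 1) cY.
rewrite /commutator_form /= mulmxBl raddfB /= (le_trans (ler_normB _ _)) //.
by rewrite mulr_natl mulr2n lerD // mxtrace_contraction //; apply: contractionM.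
Qed.

(** The endpoint (1, 0): cyclicity isolates X, and Y and Z are contractions. *)
Lemma commutator_form_le_sum1 x y z :
  (forall i, `|y 0 i| <= 1) -> (forall i, `|z 0 i| <= 1) ->
  `|commutator_form G H x y z| <= 2 * \sum_i `|x 0 i|.
Proof.
move=> /(contraction_sandwich 1) cY /(contraction_sandwich 2) cZ.
rewrite /commutator_form /= mulmxBl raddfB /= (le_trans (ler_normB _ _)) //.
rewrite mulr_natl mulr2n; apply: lerD.
  by rewrite -mulmxA mxtrace_mulC mxtrace_contraction //; apply: contractionM.
rewrite mxtrace_mulC (mulmxA _ (G 1 *m _ *m _)).
by rewrite mxtrace_contraction //; apply: contractionM.
Qed.

(** The endpoint (1/2, 1/2): Cauchy-Schwarz splits off Z, and Boettcher-Wenzel bounds the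
    commutator. *)
Lemma commutator_form_le_frob x y z :
  `|commutator_form G H x y z| ^+ 2 <=
  2 * (\sum_i `|x 0 i| ^+ 2) * (\sum_i `|y 0 i| ^+ 2) * (\sum_i `|z 0 i| ^+ 2).
Proof.
rewrite /commutator_form /= (le_trans (mxtrace_CauchySchwarz _ _)) //.
apply: ler_pM; rewrite ?frob2_ge0 ?frob2_sandwich_le //.
rewrite (le_trans (BoettcherWenzel _ _)) //.
by rewrite ler_pM ?mulr_ge0 ?frob2_ge0 // ?ler_pM ?frob2_ge0 // ?frob2_sandwich_le.
Qed.

Lemma commutator_form_expand : exists c : 'I_n * 'I_n * 'I_n -> C,
  forall x y z, commutator_form G H x y z =
    \sum_s c s * (x 0 s.1.1 * y 0 s.1.2 * z 0 s.2).
Proof.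
have trE (A B D : 'M[C]_n) x y z :
    \tr (diag_mx x *m A *m diag_mx y *m B *m diag_mx z *m D) =
    \sum_i \sum_j \sum_k A i j * B j k * D k i * (x 0 i * y 0 j * z 0 k).
  apply: eq_bigr => i _; rewrite mxE exchange_big; apply: eq_bigr => k _.
  rewrite mul_mx_diag mxE mxE mulr_suml mulr_suml; apply: eq_bigr => j _.
  by rewrite mul_mx_diag mxE mul_diag_mx mxE; ring.
(* Rotated cyclically, each of the two traces alternates the diagonals with products [H a *m G b],
   whose entries supply the coefficients. *)
exists (fun s =>
  (H 0 *m G 1) s.1.1 s.1.2 * (H 1 *m G 2) s.1.2 s.2 * (H 2 *m G 0) s.2 s.1.1 -
  (H 1 *m G 0) s.1.2 s.1.1 * (H 0 *m G 2) s.1.1 s.2 * (H 2 *m G 1) s.2 s.1.2).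
move=> x y z.
rewrite /commutator_form /= mulmxBl raddfB /=.
transitivity (
  \tr (diag_mx x *m (H 0 *m G 1) *m diag_mx y *m (H 1 *m G 2) *m diag_mx z *m
       (H 2 *m G 0)) -
  \tr (diag_mx y *m (H 1 *m G 0) *m diag_mx x *m (H 0 *m G 2) *m diag_mx z *m
       (H 2 *m G 1))).
  by congr (_ - _); rewrite -!mulmxA [LHS]mxtrace_mulC !mulmxA.
have sum3 (F : 'I_n -> 'I_n -> 'I_n -> C) :
    \sum_i \sum_j \sum_k F i j k = \sum_s F s.1.1 s.1.2 s.2.
  by rewrite pair_bigA pair_bigA.
rewrite !trE [X in _ - X]exchange_big !sum3 -sumrB.
by apply: eq_bigr => -[[i j] k] _ /=; ring.
Qed.

End CommutatorForm.

End Frobenius.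

Local Open Scope complex_scope.

(** * Interpolation of polynomials in independent phases *)

(** X^N - 1 splits and is separable in characteristic 0; its N distinct roots include a primitive
    one. *)
Lemma closed_prim_root_exists (C : numClosedFieldType) N :
  (0 < N)%N -> exists z : C, N.-primitive_root z.
Proof.
move=> N_gt0; have [r Er] := closed_field_poly_normal ('X^N - 1 : {poly C}).
rewrite (monicP _) ?monicXnsubC // scale1r in Er.
have rN : all N.-unity_root r by apply/allP=> z; rewrite -root_prod_XsubC -Er.
have sz_r : (N < (size r).+1)%N by rewrite -(size_prod_XsubC r id) -Er size_XnsubC.
have [|z] := hasP (has_prim_root N_gt0 rN _ sz_r); last by exists z.
by rewrite -separable_prod_XsubC -Er separable_Xn_sub_1 // pnatr_eq0 -lt0n.
Qed.

Section Coefficients.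
Variables (C : numClosedFieldType) (V : finType).

(** A polynomial of degree below N in each variable; its multi-indices form a finite type of
    cardinality N^|V|, the count used by the power trick. *)
Definition phase_poly N (A : {ffun V -> 'I_N} -> C) (u : V -> C) :=
  \sum_m A m * \prod_v u v ^+ m v.

(** A discrete Cauchy estimate: exponents are at most N, so averaging over the (N + 1)-th roots of
    unity in each variable isolates one coefficient exactly. *)
Lemma phase_poly_coef_le N (A : {ffun V -> 'I_N.+1} -> C) (rho : V -> C) B :
  (forall u, (forall v, `|u v| = 1) ->
     `|phase_poly A (fun v => rho v * u v)| <= B) ->
  forall m, `|A m| * \prod_v `|rho v| ^+ m v <= B.
Proof.
move=> HB m.
have [w w_prim] := closed_prim_root_exists C (ltn0Sn N).
have w_norm : `|w| = 1.
  apply/eqP; rewrite -(@pexpr_eq1 _ _ N.+1) ?normr_ge0 // -normrX.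
  by rewrite (prim_expr_order w_prim) normr1.
have w0 : w != 0 by rewrite -normr_gt0 w_norm.
(* Orthogonality of the characters of the cyclic group of order N + 1. *)
have char_sum (a b : 'I_N.+1) :
    \sum_(t < N.+1) (w ^+ t) ^+ a * (w ^+ t) ^- b = if a == b then N.+1%:R else 0.
  have -> : \sum_(t < N.+1) (w ^+ t) ^+ a * (w ^+ t) ^- b =
      \sum_(t < N.+1) (w ^+ a / w ^+ b) ^+ t.
    apply: eq_bigr => t _.
    by rewrite exprMn exprVn -!exprM (mulnC a) (mulnC b).
  have [->|neq_ab] := eqVneq a b.
    under eq_bigr => t _ do rewrite divff ?expf_neq0 // expr1n.
    by rewrite sumr_const card_ord.
  set x := w ^+ a / w ^+ b.
  have x1 : x - 1 != 0.
    rewrite subr_eq0; apply: contraNneq neq_ab => /divr1_eq /eqP.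
    by rewrite (eq_prim_root_expr w_prim) !modn_small.
  apply: (mulfI x1); rewrite -subrX1 mulr0 /x exprMn exprVn -!exprM.
  rewrite ![(_ * N.+1)%N]mulnC !exprM (prim_expr_order w_prim) !expr1n divr1.
  by rewrite subrr.
pose T := {ffun V -> 'I_N.+1}.
have extract : \sum_(t : T) phase_poly A (fun v => rho v * w ^+ t v) *
    \prod_v (w ^+ t v) ^- m v =
    (A m * \prod_v rho v ^+ m v) * \prod_(v : V) N.+1%:R.
  have term (m' : T) : \sum_(t : T)
      A m' * (\prod_v (rho v * w ^+ t v) ^+ m' v) * \prod_v (w ^+ t v) ^- m v =
      A m' * (\prod_v rho v ^+ m' v) *
      \prod_v (if m' v == m v :> 'I_N.+1 then N.+1%:R else 0).
    have -> : \prod_v (if m' v == m v :> 'I_N.+1 then N.+1%:R else 0) =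
        \prod_v \sum_(t < N.+1) (w ^+ t) ^+ m' v * (w ^+ t) ^- m v.
      by apply: eq_bigr => v _; exact/esym/char_sum.
    rewrite bigA_distr_bigA mulr_sumr; apply: eq_bigr => t _.
    rewrite -!mulrA; congr (_ * _); rewrite -!big_split /=.
    by apply: eq_bigr => v _; rewrite exprMn mulrA.
  transitivity (\sum_(t : T) \sum_(m' : T)
      A m' * (\prod_v (rho v * w ^+ t v) ^+ m' v) * \prod_v (w ^+ t v) ^- m v).
    by apply: eq_bigr => t _; rewrite mulr_suml.
  rewrite exchange_big /= (bigD1 m) //= [X in _ + X]big1 ?addr0 => [|m' m'_neq].
    by rewrite term; congr (_ * _); apply: eq_bigr => v _; rewrite eqxx.
  rewrite term; have [v mv] : exists v, m' v != m v :> 'I_N.+1.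
    apply/existsP; apply: contraR m'_neq => /existsPn mm'.
    by apply/eqP/ffunP => v; apply/eqP; have := mm' v; rewrite negbK.
  by rewrite [X in _ * X](bigD1 v) //= (negPf mv) mul0r mulr0.
have NV_gt0 : 0 < \prod_(v : V) N.+1%:R :> C by rewrite prodr_gt0.
rewrite -(ler_pM2r NV_gt0) -{1}(gtr0_norm NV_gt0).
have -> : \prod_v `|rho v| ^+ m v = `|\prod_v rho v ^+ m v|.
  by rewrite normr_prod; apply: eq_bigr => v _; rewrite normrX.
rewrite -!normrM -extract (le_trans (ler_norm_sum _ _ _)) //.
have -> : B * \prod_(v : V) N.+1%:R = \sum_(t : T) B.
  rewrite sumr_const card_ffun card_ord prodr_const.
  by rewrite -natrX mulr_natr.
apply: ler_sum => t _; rewrite normrM [X in _ * X](_ : _ = 1) ?mulr1.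
  by apply: HB => v; rewrite normrX w_norm expr1n.
by rewrite normr_prod big1 // => v _; rewrite normfV !normrX w_norm !expr1n invr1.
Qed.

(** The power expands over n-tuples f of monomials, grouped by their total multi-exponent
    [deg f]. *)
Lemma phase_poly_exp (S : finType) (E : S -> V -> nat) (c : S -> C) D n :
  (forall s v, (E s v <= D)%N) ->
  exists A : {ffun V -> 'I_(n * D).+1} -> C, forall u,
    (\sum_s c s * \prod_v u v ^+ E s v) ^+ n = phase_poly A u.
Proof.
move=> ED.
(* [inord] never takes its default value, since each total exponent is at most n * D. *)
pose deg (f : {ffun 'I_n -> S}) : {ffun V -> 'I_(n * D).+1} :=
  [ffun v => inord (\sum_l E (f l) v)].
have degE f v : deg f v = (\sum_l E (f l) v)%N :> nat.
  rewrite ffunE inordK // ltnS -[X in (_ <= X * _)%N]card_ord -sum_nat_const.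
  exact: leq_sum.
exists (fun m => \sum_(f | deg f == m) \prod_l c (f l)) => u.
rewrite -[X in _ ^+ X]card_ord -prodr_const bigA_distr_bigA /=.
rewrite (partition_big deg xpredT) //=; apply: eq_bigr => m _.
rewrite mulr_suml; apply: eq_bigr => f /eqP <-.
rewrite big_split /= exchange_big /=; congr (_ * _).
by apply: eq_bigr => v _; rewrite degE expr_sum.
Qed.

End Coefficients.

(** A factor polynomial in n cannot offset the geometric growth of (a / b)^n when a > b. *)
Lemma le_of_exp_le (R : realType) (a b : R) (D K : nat) :
  0 <= a -> 0 <= b ->
  (forall n, a ^+ n <= ((n * D).+1 ^ K)%N%:R * b ^+ n) -> a <= b.
Proof.
move=> a_ge0 b_ge0 Hab; rewrite leNgt; apply/negP => ba.
have [b0|b_neq0] := eqVneq b 0.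
  by have := Hab 1; rewrite !expr1 b0 mulr0 -b0 leNgt ba.
have b_gt0 : 0 < b by rewrite lt_def b_neq0.
pose q := a / b; have q_gt1 : 1 < q by rewrite ltr_pdivlMr // mul1r.
have q_ge0 : 0 <= q by rewrite ltW // (lt_trans ltr01).
(* With a root of order 2 (K + 1), Bernoulli gives q^n >= (n h)^(2 (K + 1)), twice the degree of the
   upper bound (n D + 1)^(K + 1). Using K + 1 covers K = 0. *)
pose s := q `^ (2 * K.+1)%:R^-1; pose h := s - 1.
have s_ge0 : 0 <= s by exact: powR_ge0.
have sE : s ^+ (2 * K.+1) = q.
  by rewrite -powR_mulrn // -powRrM mulVf ?powRr1 // pnatr_eq0.
have h_gt0 : 0 < h.
  rewrite subr_gt0 ltNge; apply/negP => s1.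
  by move: q_gt1; rewrite -sE ltNge exprn_ile1.
have h_ge0 := ltW h_gt0.
have bernoulli n : n%:R * h <= s ^+ n.
  suff : 1 + n%:R * h <= s ^+ n by apply: le_trans; rewrite lerDr.
  elim: n => [|n IHn]; first by rewrite mul0r addr0 expr0.
  rewrite exprS (le_trans _ (ler_wpM2l s_ge0 IHn)) //.
  have -> : s = 1 + h by rewrite /h addrC subrK.
  have n_ge0 : 0 <= n%:R :> R by [].
  by rewrite -natr1; nra.
have bound n : (0 < n)%N -> n%:R * h ^+ 2 <= (D.+1)%:R.
  move=> n_gt0; have n_gt0' : 0 < n%:R :> R by rewrite ltr0n.
  have qn : q ^+ n <= ((n * D).+1 ^ K.+1)%N%:R.
    rewrite expr_div_n ler_pdivrMr ?exprn_gt0 // (le_trans (Hab n)) //.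
    by rewrite ler_wpM2r ?exprn_ge0 // ler_nat leq_pexp2l.
  have : ((n%:R * h) ^+ 2) ^+ K.+1 <= (n%:R * D.+1%:R) ^+ K.+1.
    apply: (@le_trans _ _ (((n * D).+1 ^ K.+1)%N%:R)).
      apply: le_trans qn; rewrite -sE -!exprM [(2 * K.+1 * n)%N]mulnC [X in _ <= X]exprM.
      by rewrite lerXn2r ?nnegrE ?bernoulli ?exprn_ge0 ?mulr_ge0.
    rewrite -natrM -natrX ler_nat leq_exp2r //.
    by rewrite mulnS -addn1 addnC leq_add2r.
  rewrite ler_pXn2r ?nnegrE ?exprn_ge0 ?mulr_ge0 //.
  by rewrite exprMn expr2 -mulrA ler_pM2l.
have h2_gt0 : 0 < h ^+ 2 by rewrite exprn_gt0.
(* Any n above (D + 1) / h^2 contradicts [bound]. *)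
have := bound (Num.truncn (D.+1%:R / h ^+ 2)).+1 isT.
rewrite leNgt -ltr_pdivrMr // => /negP; apply; apply: real_truncnS_gt.
exact: num_real.
Qed.

(** * Weighted geometric means and the interpolation theorem *)

Section PowerMeans.
Variables (R : realType) (K : finType) (theta : K -> R).
Hypothesis sum_theta : \sum_k theta k = 1.

Lemma prod_powR_const (a : R) : 0 <= a -> \prod_k a `^ theta k = a.
Proof.
rewrite le_eqVlt => /orP[/eqP <-|a_gt0].
  (* For a = 0 a nonzero exponent is required, because 0^0 is 1. *)
  have [k theta_k] : exists k, theta k != 0.
    apply/existsP; apply: contraTT (oner_neq0 R) => /existsPn theta0.
    rewrite negbK -sum_theta big1 // => k _.
    by apply/eqP; have := theta0 k; rewrite negbK.
  by rewrite (bigD1 k) //= powR0 // mul0r.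
rewrite -[RHS]powRr1 ?ltW // -sum_theta.
apply: (big_rec2 (fun x y => x = a `^ y)) => [|k x y _ ->]; first by rewrite powRr0.
by rewrite powRD // (gt_eqF a_gt0) implybT.
Qed.

Lemma powR_prod (I : finType) (f : I -> R) (t : R) :
  (forall i, 0 <= f i) -> (\prod_i f i) `^ t = \prod_i f i `^ t.
Proof.
move=> f_ge0.
suff [] : 0 <= \prod_i f i /\ (\prod_i f i) `^ t = \prod_i f i `^ t by [].
apply: (big_rec2 (fun x y => 0 <= y /\ y `^ t = x)).
  by rewrite powR1.
by move=> i x y _ [y_ge0 <-]; rewrite mulr_ge0 // powRM.
Qed.

Lemma powRX (a t : R) n : 0 <= a -> (a ^+ n) `^ t = (a `^ t) ^+ n.
Proof.
move=> a_ge0; rewrite -(powR_mulrn n a_ge0) -(powR_mulrn n (powR_ge0 a t)).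
exact: powRAC.
Qed.

End PowerMeans.

(* The three lines theorem without complex analysis: the [n]-th power of [P] has
   polynomially many coefficients, each bounded at all the [rho k] at once. *)
Theorem multilinear_interpolation (R : realType) (S V K : finType)
    (E : S -> V -> nat) (D : nat) (c : S -> R[i])
    (theta : K -> R) (rho : K -> V -> R) (B : K -> R)
    (P := fun u : V -> R[i] => \sum_s c s * \prod_v u v ^+ E s v) :
  (forall s v, (E s v <= D)%N) ->
  (forall k, 0 <= theta k) -> \sum_k theta k = 1 ->
  (forall k v, 0 <= rho k v) -> (forall k, 0 <= B k) ->
  (forall k u, (forall v, `|u v| = 1) ->
    `|P (fun v => (rho k v)%:C * u v)| <= (B k)%:C) ->
  `|P (fun v => (\prod_k rho k v `^ theta k)%:C)| <=
    (\prod_k B k `^ theta k)%:C.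
Proof.
move=> ED theta_ge0 sum_theta rho_ge0 B_ge0 HB.
pose r v := \prod_k rho k v `^ theta k; pose b := \prod_k B k `^ theta k.
rewrite -/b; change (`|P (fun v => (r v)%:C)| <= b%:C).
have r_ge0 v : 0 <= r v by apply: prodr_ge0 => k _; exact: powR_ge0.
have b_ge0 : 0 <= b by apply: prodr_ge0 => k _; exact: powR_ge0.
have normE (z : R[i]) : `|z| = (complex.Re `|z|)%:C.
  by rewrite RRe_real // normr_real.
rewrite normE lecR; apply: (@le_of_exp_le _ _ _ D #|V|) => // [|n].
  by rewrite -ler0c -normE.
have [A PA] := phase_poly_exp c n ED.
pose a m := complex.Re `|A m|.
have a_ge0 m : 0 <= a m by rewrite -ler0c -normE.
(* The bound on |P| at the radii rho k, raised to the power n, passes to every coefficient of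
   P^n. *)
have a_le k m : a m * \prod_v rho k v ^+ m v <= B k ^+ n.
  have /(_ m) : forall m, `|A m| * \prod_v `|(rho k v)%:C| ^+ m v <= (B k ^+ n)%:C.
    apply: phase_poly_coef_le => u u1; rewrite -PA normrX rmorphXn.
    by apply: lerXn2r; rewrite ?nnegrE ?normr_ge0 ?ler0c //; exact: HB.
  rewrite normE; under eq_bigr => v _ do rewrite ger0_norm ?ler0c // -rmorphXn.
  by rewrite -rmorph_prod -rmorphM lecR.
(* The weighted geometric mean of these bounds over k; [a m] is its own mean since the weights sum
   to 1. *)
have a_le_r m : a m * \prod_v r v ^+ m v <= b ^+ n.
  have -> : b ^+ n = \prod_k (B k ^+ n) `^ theta k.
    by rewrite /b -prodrXl; apply: eq_bigr => k _; rewrite powRX.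
  have -> : a m * \prod_v r v ^+ m v =
      \prod_k (a m * \prod_v rho k v ^+ m v) `^ theta k.
    rewrite -{1}(prod_powR_const sum_theta (a_ge0 m)).
    have -> : \prod_v r v ^+ m v =
        \prod_v \prod_k (rho k v `^ theta k) ^+ m v.
      by apply: eq_bigr => v _; rewrite prodrXl.
    rewrite exchange_big -big_split; apply: eq_bigr => k _ /=.
    rewrite powRM ?prodr_ge0 // => [|v _]; last by rewrite exprn_ge0.
    rewrite powR_prod => [|v]; last by rewrite exprn_ge0.
    by congr (_ * _); apply: eq_bigr => v _; rewrite powRX.
  apply: ler_prod => k _; rewrite powR_ge0 /= ge0_ler_powR ?nnegrE ?exprn_ge0 //.
  by rewrite mulr_ge0 // prodr_ge0 // => v _; rewrite exprn_ge0.
rewrite -lecR rmorphXn /= -normE -normrX PA /phase_poly.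
rewrite (le_trans (ler_norm_sum _ _ _)) //.
(* The triangle inequality costs only the number of multi-indices, polynomial in n. *)
have -> : ((n * D).+1 ^ #|V|)%N%:R * b ^+ n =
    \sum_(m : {ffun V -> 'I_(n * D).+1}) b ^+ n.
  by rewrite sumr_const card_ffun card_ord mulr_natl.
rewrite rmorph_sum; apply: ler_sum => m _.
rewrite normrM normE normr_prod.
under eq_bigr => v _ do rewrite normrX ger0_norm ?ler0c // -rmorphXn.
rewrite -rmorph_prod -rmorphM lecR. exact: a_le_r.
Qed.

(** * The commutator form on unit balls *)

Section UnitBall.
Variable R : realType.

(** For nonnegative exponents the law survives at x = 0, as r + s vanishes only if both do. *)
Lemma powRD_ge0 (x r s : R) :
  0 <= r -> 0 <= s -> x `^ (r + s) = x `^ r * x `^ s.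
Proof.
move=> r_ge0 s_ge0; have [->|x0] := eqVneq x 0; last by rewrite powRD // x0 implybT.
rewrite /powR eqxx paddr_eq0 //; do 2![case: eqP => _]; rewrite ?mulr1 ?mulr0 //.
Qed.

(* The unit ball of l^(1/e); at the exponent [e = 0] this is l^oo. *)
Definition unit_ball (I : finType) (e : R) (x : I -> R) :=
  (forall i, 0 <= x i <= 1) /\ (0 < e -> \sum_i x i `^ e^-1 <= 1).

(** Entries are at most 1, so the larger exponent 1/t decreases every term. *)
Lemma unit_ballW (I : finType) (e t : R) (x : I -> R) :
  0 <= t -> t <= e -> unit_ball e x -> unit_ball t x.
Proof.
move=> t_ge0 te [x01 sumx]; split=> // t_gt0.
have e_gt0 : 0 < e by exact: lt_le_trans te.
apply: le_trans (sumx e_gt0); apply: ler_sum => i _.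
have /andP[xi_ge0 xi1] := x01 i.
move: xi_ge0; rewrite le_eqVlt => /orP[/eqP<-|xi_gt0].
  by rewrite !powR0 ?invr_eq0 ?gt_eqF.
by rewrite ger_powR ?xi_gt0 // lef_pV2 ?posrE.
Qed.

(** A point of the l^(1/e) ball is a geometric mean of points of the l^oo, l^1 and l^2 balls when
    the weights average 0, 1, 1/2 to e. This takes the place of the analytic family in
    Riesz-Thorin. *)
Lemma unit_ball_factor (I : finType) (t0 t1 tm : R) (x : I -> R) :
  0 <= t0 -> 0 <= t1 -> 0 <= tm -> t0 + t1 + tm = 1 ->
  unit_ball (t1 + tm / 2) x ->
  exists r0 r1 rm : I -> R,
  [/\ forall i, 0 <= r0 i <= 1,
      (forall i, 0 <= r1 i) /\ \sum_i r1 i <= 1,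
      (forall i, 0 <= rm i) /\ \sum_i rm i ^+ 2 <= 1 &
      forall i, x i = r0 i `^ t0 * r1 i `^ t1 * rm i `^ tm].
Proof.
move=> t0_ge0 t1_ge0 tm_ge0 sum_t; set e := t1 + tm / 2 => -[x01 sumx].
have e_ge0 : 0 <= e by rewrite addr_ge0 // divr_ge0.
have tm2_ge0 : 0 <= tm / 2 by rewrite divr_ge0.
have x_ge0 i : 0 <= x i by have /andP[] := x01 i.
move: e_ge0; rewrite le_eqVlt => /orP[/eqP/esym e0|e_gt0].
  have [t10 tm0] : t1 = 0 /\ tm = 0 by rewrite /e in e0; split; lra.
  (* Here the l^1 and l^2 factors carry exponent 0, and 0^0 is 1, so zero vectors serve. *)
  exists x, (fun=> 0), (fun=> 0); split=> [//|||i].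
  - by split=> //; rewrite big1.
  - by split=> //; rewrite big1 // => i _; rewrite expr0n.
  - have -> : t0 = 1 by lra.
    by rewrite t10 tm0 !powRr0 !mulr1 powRr1.
(* The power x^(1/e) lies in the l^1 ball and its square root in the l^2 ball. *)
exists (fun=> 1), (fun i => x i `^ e^-1), (fun i => x i `^ e^-1 `^ 2^-1).
split=> [i|||i]; first by rewrite ler01 lexx.
- by split=> [i|]; [exact: powR_ge0 | exact: sumx].
- split=> [i|]; first exact: powR_ge0.
  apply: le_trans (sumx e_gt0); apply: ler_sum => i _.
  by rewrite -powR_mulrn ?powR_ge0 // -powRrM mulVf ?powRr1 ?powR_ge0.
- rewrite powR1 mul1r -[X in _ * X]powRrM [2^-1 * _]mulrC -powRD_ge0 // -/e.
  by rewrite -powRrM mulVf ?gt_eqF // powRr1.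
Qed.

End UnitBall.

Section CommutatorFormReal.
Variables (R : realType) (n : nat) (G H : 'I_3 -> 'M[R[i]]_n).
Hypotheses (cG : forall a, contraction_mx (G a)) (cH : forall a, contraction_mx (H a)).

Local Notation rowC x := (\row_i (x i)%:C).

(** The variables are pairs (a, i) of a slot and an index; such a variable has exponent 1 in the
    monomial s if i is the a-th component of s, and 0 otherwise. *)
Lemma commutator_form_poly : exists c : 'I_n * 'I_n * 'I_n -> R[i],
  forall u : 'I_3 * 'I_n -> R[i],
  commutator_form G H (\row_i u (0, i)) (\row_i u (1, i)) (\row_i u (2, i)) =
  \sum_s c s * \prod_v u v ^+ (nth s.2 [:: s.1.1; s.1.2] v.1 == v.2).
Proof.
have [c cE] := commutator_form_expand G H; exists c => u; rewrite cE.
apply: eq_bigr => s _; congr (_ * _); rewrite !mxE.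
transitivity (\prod_(a < 3) \prod_(i < n)
    u (a, i) ^+ (nth s.2 [:: s.1.1; s.1.2] a == i)); last first.
  by rewrite pair_bigA; apply: eq_bigr => -[].
have pick (a : 'I_3) j : \prod_(i < n) u (a, i) ^+ (j == i) = u (a, j).
  by rewrite (bigD1 j) //= eqxx big1 ?mulr1 // => i; rewrite eq_sym => /negPf->.
rewrite !big_ord_recl big_ord0 mulr1 mulrA /= !pick.
by congr (u (_, _) * u (_, _) * u (_, _)); apply: val_inj.
Qed.

Let norm_real (x : R) : 0 <= x -> `|x%:C| = x%:C.
Proof. by move=> x_ge0; rewrite ger0_norm ?ler0c. Qed.

Lemma commutator_form_le (e t : R) (x y z : 'I_n -> R) :
  0 <= t -> t <= e -> t <= 1 - e ->
  unit_ball e x -> unit_ball t y -> unit_ball (1 - e) z ->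
  `|commutator_form G H (rowC x) (rowC y) (rowC z)| <= (2 `^ (1 - t))%:C.
Proof.
move=> t_ge0 te te' ux uy uz.
(* Barycentric coordinates of (e, t) with respect to (0, 0), (1, 0) and (1/2, 1/2); the hypotheses
   on t make them nonnegative. *)
pose t0 := 1 - e - t; pose t1 := e - t; pose tm := 2 * t.
have t0_ge0 : 0 <= t0 by rewrite /t0; lra.
have t1_ge0 : 0 <= t1 by rewrite /t1; lra.
have tm_ge0 : 0 <= tm by rewrite /tm; lra.
have ex : e = t1 + tm / 2 by rewrite /t1 /tm; lra.
have ey : t = 0 + tm / 2 by rewrite /tm; lra.
have ez : 1 - e = t0 + tm / 2 by rewrite /t0 /tm; lra.
rewrite ex in ux; rewrite ez in uz; rewrite [in unit_ball _ y]ey in uy.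
have sx : t0 + t1 + tm = 1 by rewrite /t0 /t1 /tm; lra.
have sy : t0 + t1 + 0 + tm = 1 by rewrite /t0 /t1 /tm; lra.
have sz : t1 + t0 + tm = 1 by rewrite /t0 /t1 /tm; lra.
have [x0 [x1 [xm [x0_1 [x1_ge0 sum_x1] [xm_ge0 sum_xm] xE]]]] :=
  unit_ball_factor t0_ge0 t1_ge0 tm_ge0 sx ux.
(* Both (0, 0) and (1, 0) place y in the l^oo ball, so their weights merge and one y0 serves
   both. *)
have [y0 [y1 [ym [y0_1 _ [ym_ge0 sum_ym] yE]]]] :=
  unit_ball_factor (addr_ge0 t0_ge0 t1_ge0) (lexx 0) tm_ge0 sy uy.
(* For z the exponents are conjugate, l^1 at (0, 0) and l^oo at (1, 0), so t0 and t1 trade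
   places. *)
have [z0 [z1 [zm [z0_1 [z1_ge0 sum_z1] [zm_ge0 sum_zm] zE]]]] :=
  unit_ball_factor t1_ge0 t0_ge0 tm_ge0 sz uz.
pose theta (k : 'I_3) := [:: t0; t1; tm]`_k.
(* Rows are the endpoints, columns the slots x, y, z. *)
pose rho (k : 'I_3) (v : 'I_3 * 'I_n) := nth 0 (nth [::]
  [:: [:: x0 v.2; y0 v.2; z1 v.2];
      [:: x1 v.2; y0 v.2; z0 v.2];
      [:: xm v.2; ym v.2; zm v.2]] k) v.1.
pose B (k : 'I_3) := [:: 2 : R; 2; 2 `^ 2^-1]`_k.
have [c cE] := commutator_form_poly.
have all3 (Q : 'I_3 -> Prop) : Q 0 -> Q 1 -> Q 2 -> forall k, Q k.
  move=> Q0 Q1 Q2 -[[|[|[|//]]] k3].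
  - by rewrite (_ : Ordinal k3 = 0) //; apply: val_inj.
  - by rewrite (_ : Ordinal k3 = 1) //; apply: val_inj.
  - by rewrite (_ : Ordinal k3 = 2) //; apply: val_inj.
have x0_ge0 i : 0 <= x0 i by have /andP[] := x0_1 i.
have y0_ge0 i : 0 <= y0 i by have /andP[] := y0_1 i.
have z0_ge0 i : 0 <= z0 i by have /andP[] := z0_1 i.
have prodE (f : 'I_3 -> R) : \prod_k f k = f 0 * f 1 * f 2.
  rewrite !big_ord_recl big_ord0 mulr1 mulrA.
  by congr (f _ * f _ * f _); apply: val_inj.
have sumE (f : 'I_3 -> R) : \sum_k f k = f 0 + f 1 + f 2.
  rewrite !big_ord_recl big_ord0 addr0 addrA.
  by congr (f _ + f _ + f _); apply: val_inj.
have theta_ge0 k : 0 <= theta k by move: k; apply: (all3).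
have sum_theta : \sum_k theta k = 1 by rewrite sumE.
have rho_ge0 k v : 0 <= rho k v.
  by case: v => a i; move: k a; apply: (all3); apply: (all3); rewrite /rho /=; auto.
have B_ge0 k : 0 <= B k by move: k; apply: (all3); rewrite // /B /= powR_ge0.
have E1 (s : 'I_n * 'I_n * 'I_n) (v : 'I_3 * 'I_n) :
  (nth s.2 [:: s.1.1; s.1.2] v.1 == v.2 <= 1)%N by case: (_ == _).
have := @multilinear_interpolation R _ _ _ _ 1 c theta rho B E1
  theta_ge0 sum_theta rho_ge0 B_ge0.
rewrite -cE (_ : \prod_k B k `^ theta k = 2 `^ (1 - t)); last first.
  rewrite prodE /B /theta /= -powRrM -!powRD ?pnatr_eq0 ?implybT //.
  by congr (_ `^ _); rewrite /t0 /t1 /tm; lra.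
have -> : (\row_i (\prod_k rho k (0, i) `^ theta k)%:C) = rowC x.
  by apply/rowP => i; rewrite !mxE prodE xE.
have -> : (\row_i (\prod_k rho k (1, i) `^ theta k)%:C) = rowC y.
  apply/rowP => i; rewrite !mxE prodE yE (powRD_ge0 _ t0_ge0 t1_ge0) powRr0 mulr1.
  by [].
have -> : (\row_i (\prod_k rho k (2, i) `^ theta k)%:C) = rowC z.
  by apply/rowP => i; rewrite !mxE prodE zE /rho /theta /=; congr (_ * _)%:C; rewrite mulrC.
apply => k u u1; rewrite -cE.
have entry a (f : 'I_n -> R) i : (forall j, 0 <= f j) ->
    `|(f i)%:C * u (a, i)| = (f i)%:C.
  by move=> f_ge0; rewrite normrM u1 mulr1 norm_real.
(* One goal per endpoint; phases of modulus 1 leave the moduli of the entries unchanged. *)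
move: k; apply: (all3).
- have sum_z : \sum_i `|(\row_i ((z1 i)%:C * u (2, i))) 0 i| <= 1.
    under eq_bigr => i _ do rewrite mxE entry //.
    by rewrite -rmorph_sum lecR.
  apply: le_trans (commutator_form_le_sum3 cG cH _ _ _) _ => [i|i|].
  - by rewrite mxE entry // lecR; have /andP[] := x0_1 i.
  - by rewrite mxE entry // lecR; have /andP[] := y0_1 i.
  - by rewrite (_ : (B 0)%:C = 2 * 1) ?ler_pM2l // mulr1 rmorph_nat.
- have sum_x : \sum_i `|(\row_i ((x1 i)%:C * u (0, i))) 0 i| <= 1.
    under eq_bigr => i _ do rewrite mxE entry //.
    by rewrite -rmorph_sum lecR.
  apply: le_trans (commutator_form_le_sum1 cG cH _ _ _) _ => [i|i|].
  - by rewrite mxE entry // lecR; have /andP[] := y0_1 i.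
  - by rewrite mxE entry // lecR; have /andP[] := z0_1 i.
  - by rewrite (_ : (B 1)%:C = 2 * 1) ?ler_pM2l // mulr1 rmorph_nat.
- have sum2 (f : 'I_n -> R) (a : 'I_3) : (forall j, 0 <= f j) ->
      \sum_i f i ^+ 2 <= 1 ->
      \sum_i `|(\row_i ((f i)%:C * u (a, i))) 0 i| ^+ 2 <= 1.
    move=> f_ge0 sum_f; under eq_bigr => i _ do rewrite mxE entry // -rmorphXn.
    by rewrite -rmorph_sum lecR.
  rewrite -(@ler_pXn2r _ 2) ?nnegrE ?normr_ge0 ?ler0c ?B_ge0 //.
  apply: le_trans (commutator_form_le_frob cG cH _ _ _) _.
  have -> : ((B 2)%:C ^+ 2 : R[i]) = 2 * 1 * 1 * 1.
    rewrite !mulr1 -rmorphXn /B /= -powR_mulrn ?powR_ge0 // -powRrM mulVf //.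
    by rewrite powRr1 // rmorph_nat.
  have norm2_ge0 (v : 'rV[R[i]]_n) : 0 <= \sum_i `|v 0 i| ^+ 2.
    by apply: sumr_ge0 => i _; rewrite exprn_ge0.
  by rewrite !ler_pM ?mulr_ge0 //; apply: sum2.
Qed.

End CommutatorFormReal.

(** * Singular values and Schatten norms *)

Section SchattenNorm.
Variables (R : realType) (d : nat).
Implicit Types (X Y : 'M[R[i]]_d) (p : \bar R).

(** Kept in the order of the eigenvectors, unsorted, to fit into a decomposition of X. *)
Definition singular_value X (i : 'I_d) : R :=
  Num.sqrt (complex.Re (spectral_diag (X^t* *m X) 0 i)).

Lemma perm_singular_values X :
  perm_eq (singular_values X) [seq singular_value X i | i : 'I_d].
Proof. by rewrite /singular_values perm_sort. Qed.

Lemma schatten_fin (a : R) X :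
  schatten a%:E X = (\sum_i singular_value X i `^ a) `^ a^-1.
Proof.
rewrite /schatten (perm_big _ (perm_singular_values X)) /=.
by rewrite big_map big_enum.
Qed.

Lemma schatten_infty_ge X i : singular_value X i <= schatten +oo X.
Proof.
rewrite /schatten.
have : sorted (fun x y : R => y <= x) (singular_values X).
  by apply: sort_sorted => x y; exact: le_total.
have : singular_value X i \in singular_values X.
  by rewrite (perm_mem (perm_singular_values X)) map_f ?mem_enum.
case: (singular_values X) => // x s /=; rewrite inE => /orP[/eqP->//|si].
have tr : transitive (fun x y : R => y <= x).
  by move=> y z w yz wy; exact: le_trans wy yz.
by move=> /(order_path_min tr)/allP/(_ _ si).
Qed.

Lemma schatten_infty_attained X : (0 < d)%N ->
  exists i, schatten +oo X = singular_value X i.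
Proof.
move=> d_gt0; have : schatten +oo X \in singular_values X.
  rewrite /schatten; move: (perm_size (perm_singular_values X)).
  rewrite size_map size_enum_ord; case: (singular_values X) => [/esym d0|x s _].
    by rewrite d0 in d_gt0.
  by rewrite mem_head.
by rewrite (perm_mem (perm_singular_values X)) => /mapP[i _ ->]; exists i.
Qed.

Lemma singular_value_ge0 X i : 0 <= singular_value X i.
Proof. exact: sqrtr_ge0. Qed.

Lemma gram_normalmx X : X^t* *m X \is normalmx.
Proof. by apply/normalmxP; rewrite adjmxM trmxCK. Qed.

(** In the eigenbasis the diagonal consists of squared column norms of [X *m P^t*], so real part and
    square root lose nothing. *)
Lemma spectral_diag_gram X i :
  spectral_diag (X^t* *m X) 0 i = (singular_value X i ^+ 2)%:C.
Proof.
set P := spectralmx (X^t* *m X); set w := spectral_diag _.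
have Pu : P \is unitarymx by exact: spectral_unitarymx.
have PPt : P *m P^t* = 1%:M by apply/unitarymxP.
have XX : (X *m P^t*)^t* *m (X *m P^t*) = diag_mx w.
  have /orthomx_spectralP := gram_normalmx X; rewrite -/P -/w invmx_unitary // => E.
  rewrite adjmxM trmxCK !mulmxA -(mulmxA P) E.
  by rewrite !mulmxA PPt mul1mx -mulmxA PPt mulmx1.
have w_ge0 : 0 <= w 0 i.
  have /matrixP/(_ i i) := XX; rewrite !mxE eqxx mulr1n => <-.
  by apply: sumr_ge0 => j _; rewrite !mxE mulrC mul_conjC_ge0.
rewrite sqr_sqrtr -?ler0c ?RRe_real ?ger0_real //.
Qed.

(* [U] is only a partial isometry, with initial space the orthogonal of [ker X]. *)
Theorem singular_value_decomposition X : exists U V : 'M[R[i]]_d,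
  [/\ V \is unitarymx, contraction_mx U,
      X = U *m diag_mx (\row_i (singular_value X i)%:C) *m V &
      forall z : 'I_d -> R,
        \tr (X *m (V^t* *m diag_mx (\row_i (z i)%:C) *m U^t*)) =
        (\sum_i singular_value X i * z i)%:C].
Proof.
set P := spectralmx (X^t* *m X); set s := \row_i _.
have Pu : P \is unitarymx by exact: spectral_unitarymx.
have PPt : P *m P^t* = 1%:M by apply/unitarymxP.
have PtP : P^t* *m P = 1%:M by rewrite -invmx_unitary // mulVmx // unitarymx_unit.
(* Since 0^-1 = 0, s' inverts s on its support and vanishes elsewhere; e is the indicator of that
   support. *)
pose s' : 'rV[R[i]]_d := \row_i ((singular_value X i)^-1)%:C.
pose e : 'rV[R[i]]_d := \row_i (singular_value X i != 0)%:R.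
have [Q EQ] : exists Q, X *m P^t* = Q by exists (X *m P^t*).
have QQ : Q^t* *m Q = diag_mx s *m diag_mx s.
  have /orthomx_spectralP := gram_normalmx X; rewrite -/P invmx_unitary // => E.
  rewrite -EQ adjmxM trmxCK !mulmxA -(mulmxA P) E.
  rewrite !mulmxA PPt mul1mx -mulmxA PPt mulmx1 mulmx_diag; congr diag_mx.
  by apply/rowP => i; rewrite !mxE spectral_diag_gram rmorphXn expr2.
have s's : diag_mx s' *m diag_mx s = diag_mx e.
  rewrite mulmx_diag; congr diag_mx; apply/rowP => i; rewrite !mxE -rmorphM.
  have [->|s_neq0] := eqVneq (singular_value X i) 0; first by rewrite mulr0.
  by rewrite mulVf.
have diag_adj (f : 'I_d -> R) :
    (diag_mx (\row_i (f i)%:C))^t* = diag_mx (\row_i (f i)%:C) :> 'M[R[i]]_d.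
  rewrite tr_diag_mx map_diag_mx; congr diag_mx.
  apply/rowP => i; rewrite !mxE; exact: conjc_real.
have [U EU] : exists U, Q *m diag_mx s' = U by exists (Q *m diag_mx s').
have UU : U^t* *m U = diag_mx e.
  have -> : U^t* *m U = diag_mx s' *m (Q^t* *m Q) *m diag_mx s'.
    by rewrite -EU adjmxM diag_adj !mulmxA.
  rewrite QQ !mulmxA s's -mulmxA (diag_mxC s) s's mulmx_diag.
  by congr diag_mx; apply/rowP => i; rewrite !mxE -natrM mulnb andbb.
have QE : Q = U *m diag_mx s.
  rewrite -EU -mulmxA s's; apply/matrixP => j i; rewrite mul_mx_diag !mxE.
  have [s0|_] := eqVneq (singular_value X i) 0; last by rewrite mulr1.
  have /matrixP/(_ i i) := QQ; rewrite mulmx_diag !mxE eqxx mulr1n s0 mul0r.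
  move/eqP; rewrite psumr_eq0 => [/allP/(_ j)|k _]; last first.
    by rewrite !mxE mulrC mul_conjC_ge0.
  rewrite mem_index_enum => /(_ isT); rewrite !mxE mulrC mul_conjC_eq0.
  by move=> /eqP ->; rewrite mul0r.
exists U, P; split=> //.
- apply: contraction_partial_isometry UU => i.
  by rewrite mxE; case: (_ != 0); rewrite eqxx ?orbT.
- by rewrite -QE -EQ -mulmxA PtP mulmx1.
- have XE : X = U *m diag_mx s *m P by rewrite -QE -EQ -mulmxA PtP mulmx1.
  move=> z; rewrite {1}XE.
  rewrite !mulmxA -(mulmxA _ P) PPt mulmx1 mxtrace_mulC !mulmxA UU !mulmx_diag.
  rewrite /mxtrace rmorph_sum; apply: eq_bigr => i _.
  rewrite !mxE eqxx mulr1n rmorphM.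
  (* The indicator e removes only terms whose singular value is 0. *)
  by case: eqVneq => [->|_]; rewrite ?mul0r // mul1r.
Qed.

(** * Normalisation and duality of Schatten norms; the upper bound *)

Lemma schatten_ge0 p X : 0 <= schatten p X.
Proof.
case: p => [a| |] /=; [exact: powR_ge0| |by []].
rewrite /singular_values; case E: (sort _ _) => [//|x s] /=.
have : x \in singular_values X by rewrite /singular_values E mem_head.
by rewrite (perm_mem (perm_singular_values X)) => /mapP[i _ ->]; exact: sqrtr_ge0.
Qed.

Lemma recip_fin (a : R) : (1 <= a%:E)%E -> recip a%:E = a^-1.
Proof.
rewrite lee_fin => a1; rewrite /recip inver gt_eqF //.
exact: lt_le_trans ltr01 a1.
Qed.

Lemma recip_infty : recip (+oo%E : \bar R) = 0.
Proof. by rewrite /recip invey. Qed.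

Lemma recip_itv p : (1 <= p)%E -> 0 <= recip p <= 1.
Proof.
case: p => [a| |//] a1; last by rewrite recip_infty lexx ler01.
rewrite recip_fin //; rewrite lee_fin in a1.
by rewrite invr_ge0 invf_le1 ?(lt_le_trans ltr01) // (le_trans ler01 a1) a1.
Qed.

Lemma singular_value_le_schatten p X i :
  (1 <= p)%E -> singular_value X i <= schatten p X.
Proof.
case: p => [a| |//] a1; last exact: schatten_infty_ge.
rewrite lee_fin in a1; have a_gt0 : 0 < a by exact: lt_le_trans ltr01 a1.
rewrite schatten_fin -[leLHS]powRr1 ?singular_value_ge0 //.
rewrite -(mulfV (lt0r_neq0 a_gt0)) powRrM ge0_ler_powR ?nnegrE ?powR_ge0 //.
- by rewrite invr_ge0 ltW.
- by apply: sumr_ge0 => j _; exact: powR_ge0.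
- by rewrite (bigD1 i) //= lerDl sumr_ge0 // => j _; exact: powR_ge0.
Qed.

Lemma sum_powR_singular_value (a : R) X : 1 <= a -> 0 < schatten a%:E X ->
  \sum_i (singular_value X i / schatten a%:E X) `^ a = 1.
Proof.
move=> a1 N_gt0; have a_neq0 : a != 0 by rewrite gt_eqF // (lt_le_trans ltr01).
have V_ge0 : 0 <= (schatten a%:E X)^-1 by rewrite invr_ge0 ltW.
under eq_bigr => i _ do rewrite powRM ?singular_value_ge0 //.
rewrite -mulr_suml -powR_inv1 ?ltW // -powRrM mulN1r powRN.
move: N_gt0; rewrite schatten_fin; set S := \sum_i _.
have S_ge0 : 0 <= S by apply: sumr_ge0 => i _; exact: powR_ge0.
move=> N_gt0; rewrite -powRrM mulVf // powRr1 // divff //.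
by apply: contraTneq N_gt0 => ->; rewrite powR0 ?ltxx // invr_eq0.
Qed.

Lemma unit_ball_singular_value p X : (1 <= p)%E -> 0 < schatten p X ->
  unit_ball (recip p) (fun i => singular_value X i / schatten p X).
Proof.
move=> p1 N_gt0; split=> [i|].
  rewrite divr_ge0 ?singular_value_ge0 ?schatten_ge0 //=.
  by rewrite ler_pdivrMr // mul1r singular_value_le_schatten.
case: p p1 N_gt0 => [a| |//] a1 N_gt0; last by rewrite recip_infty ltxx.
by rewrite recip_fin // invrK sum_powR_singular_value.
Qed.

(* [z] realises the equality case of Hoelder's inequality. *)
Lemma schatten_dual p X : (1 <= p)%E -> (0 < d)%N ->
  exists2 z : 'I_d -> R, unit_ball (1 - recip p) z &
    schatten p X <= \sum_i singular_value X i * z i.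
Proof.
case: p => [a| |//] p1 d_gt0; last first.
  have [i0 ->] := schatten_infty_attained X d_gt0.
  (* For p = oo the dual ball is that of l^1, which contains the unit vector at a largest singular
     value. *)
  exists (fun i => (i == i0)%:R).
    split=> [i|_]; first by case: (_ == _); rewrite ?lexx ler01.
    rewrite recip_infty subr0 invr1 (bigD1 i0) //= eqxx powR1 big1 ?addr0 // => i.
    by move=> /negPf->; rewrite powR0 ?oner_eq0.
  rewrite (bigD1 i0) //= eqxx mulr1 lerDl sumr_ge0 // => i _.
  by rewrite mulr_ge0 ?singular_value_ge0.
have a1 : 1 <= a by rewrite lee_fin in p1.
have a_gt0 : 0 < a by exact: lt_le_trans ltr01 a1.
rewrite recip_fin //; have := schatten_ge0 a%:E X.
rewrite le_eqVlt => /orP[/eqP <-|N_gt0].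
  exists (fun=> 0) => [|]; last by rewrite big1 // => i _; rewrite mulr0.
  split=> [i|t_gt0]; first by rewrite lexx ler01.
  by rewrite big1 // => i _; rewrite powR0 // invr_eq0 gt_eqF.
set N := schatten _ _ in N_gt0 *.
have [ball1 _] := unit_ball_singular_value p1 N_gt0.
exists (fun i => (singular_value X i / N) `^ (a - 1)).
  split=> [i|t_gt0].
    have /andP[q_ge0 q1] := ball1 i; rewrite powR_ge0 /=.
    have one : 1 `^ (a - 1) = 1 by rewrite powR1.
    by rewrite -[leRHS]one ge0_ler_powR ?nnegrE ?subr_ge0.
  under eq_bigr => i _ do rewrite -powRrM.
  (* The inverse of 1 - 1/a is the conjugate exponent a / (a - 1); [t_gt0] excludes a = 1. *)
  have -> : (a - 1) * (1 - a^-1)^-1 = a.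
    have a_neq0 : a != 0 by rewrite gt_eqF.
    have a1_neq0 : a - 1 != 0.
      by apply: contraTneq t_gt0 => /subr0_eq ->; rewrite invr1 subrr ltxx.
    by field; rewrite a_neq0 a1_neq0.
  by rewrite sum_powR_singular_value.
rewrite -[leLHS]mulr1 -[X in _ * X <= _](sum_powR_singular_value a1 N_gt0) mulr_sumr.
apply: ler_sum => i _; have /andP[q_ge0 _] := ball1 i.
by rewrite -(mulr_powRB1 q_ge0 a_gt0) mulrA [N * _]mulrC divfK // gt_eqF.
Qed.

Lemma schatten_eq0 p X : (1 <= p)%E -> schatten p X = 0 -> X = 0.
Proof.
move=> p1 N0; have [U [V [_ _ -> _]]] := singular_value_decomposition X.
suff -> : (\row_i (singular_value X i)%:C) = 0 :> 'rV[R[i]]_d.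
  by rewrite linear0 mulmx0 mul0mx.
apply/rowP => i; rewrite !mxE (_ : singular_value X i = 0) //.
by apply/le_anti; rewrite singular_value_ge0 -N0 singular_value_le_schatten.
Qed.

(** The vector z dual to the commutator, placed in its singular bases, bounds the norm by a trace.
    Dividing the singular values of X and Y by their norms turns this trace into the commutator form
    on unit balls. *)
Theorem schatten_commutator_le p r X Y (t : R) :
  (0 < d)%N -> (1 <= p)%E -> (1 <= r)%E ->
  0 <= t -> t <= recip r -> t <= recip p -> t <= 1 - recip p ->
  schatten p (X *m Y - Y *m X) <= 2 `^ (1 - t) * schatten p X * schatten r Y.
Proof.
move=> d_gt0 p1 r1 t_ge0 tr tp tp'.
set Z := X *m Y - Y *m X.
have NX_ge0 := schatten_ge0 p X; have NY_ge0 := schatten_ge0 r Y.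
have [z z_ball Zz] := schatten_dual Z p1 d_gt0.
have [UZ [VZ [VZu cUZ ZE trZ]]] := singular_value_decomposition Z.
apply: le_trans Zz _; rewrite -lecR -trZ.
have rhs_ge0 : 0 <= 2 `^ (1 - t) * schatten p X * schatten r Y.
  by rewrite !mulr_ge0 ?powR_ge0.
move: NX_ge0; rewrite le_eqVlt => /orP[/eqP/esym NX0|NX_gt0].
  have -> : Z = 0 by rewrite /Z (schatten_eq0 p1 NX0) mul0mx mulmx0 subrr.
  by rewrite mul0mx mxtrace0 ler0c.
move: NY_ge0; rewrite le_eqVlt => /orP[/eqP/esym NY0|NY_gt0].
  have -> : Z = 0 by rewrite /Z (schatten_eq0 r1 NY0) mul0mx mulmx0 subrr.
  by rewrite mul0mx mxtrace0 ler0c.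
have [UX [VX [VXu cUX XE _]]] := singular_value_decomposition X.
have [UY [VY [VYu cUY YE _]]] := singular_value_decomposition Y.
(* The third pair carries the adjoint singular bases of Z, so that [trZ] evaluates the trace. *)
pose G (a : 'I_3) : 'M[R[i]]_d := nth 0 [:: UX; UY; VZ^t*] a.
pose H (a : 'I_3) : 'M[R[i]]_d := nth 0 [:: VX; VY; UZ^t*] a.
have cG a : contraction_mx (G a).
  rewrite /G; case: a => [[|[|[|a]]] a3] /=; first exact: cUX; first exact: cUY.
    by apply: contraction_adj; exact: contraction_unitary VZu.
  by exfalso; move: a3; rewrite !ltnS ltn0.
have cH a : contraction_mx (H a).
  rewrite /H; case: a => [[|[|[|a]]] a3] /=.
  - exact: contraction_unitary VXu.
  - exact: contraction_unitary VYu.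
  - exact: contraction_adj cUZ.
  - by exfalso; move: a3; rewrite !ltnS ltn0.
have := commutator_form_le cG cH t_ge0 tp tp'
  (unit_ball_singular_value p1 NX_gt0)
  (unit_ballW t_ge0 tr (unit_ball_singular_value r1 NY_gt0)) z_ball.
pose NX := schatten p X; pose NY := schatten r Y.
have scale (f : 'I_d -> R) (N : R) : 0 < N ->
    diag_mx (\row_i (f i)%:C) = N%:C *: diag_mx (\row_i (f i / N)%:C).
  move=> N_gt0; rewrite -linearZ; congr diag_mx; apply/rowP => i; rewrite !mxE.
  by rewrite -rmorphM mulrC divfK ?gt_eqF.
rewrite /commutator_form /G /H /=.
set FX := UX *m _ *m VX; set FY := UY *m _ *m VY; set FZ := _ *m _ *m UZ^t*.
have XF : X = NX%:C *: FX by rewrite {1}XE (scale _ NX) // -scalemxAr -scalemxAl.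
have YF : Y = NY%:C *: FY by rewrite {1}YE (scale _ NY) // -scalemxAr -scalemxAl.
have ZF : Z = (NX * NY)%:C *: (FX *m FY - FY *m FX).
  rewrite scalerBr; congr (_ - _).
    by rewrite {1}XF {1}YF -scalemxAl -scalemxAr scalerA -rmorphM.
  by rewrite {1}YF {1}XF -scalemxAl -scalemxAr scalerA -rmorphM [NY * _]mulrC.
rewrite ZF -scalemxAl mxtraceZ => form_le.
have N_ge0 : 0 <= NX * NY by rewrite mulr_ge0 ?ltW.
rewrite -/NX -/NY.
have -> : (2 `^ (1 - t) * NX * NY)%:C = (NX * NY)%:C * (2 `^ (1 - t))%:C.
  by rewrite -rmorphM -mulrA [X in X%:C]mulrC.
have N_geC : 0 <= (NX * NY)%:C by rewrite ler0c.
apply: le_trans (ler_wpM2l N_geC form_le); set T := \tr _.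
(* By [trZ] the trace is real, hence at most its modulus. *)
have re : (NX * NY)%:C * T \is Num.real.
  by rewrite /T -mxtraceZ scalemxAl -ZF /FZ trZ complex_real.
by apply: le_trans (real_ler_norm re) _; rewrite normrM ger0_norm ?ler0c.
Qed.

(** Since 2 >= 1 the maximum moves into the exponent, where it becomes 1 - t with t the minimum used
    in the upper bound. *)
Lemma maxr_powR2 (e z : R) :
  Num.max (2 `^ e) (Num.max (2 `^ (1 - e)) (2 `^ (1 - z))) =
  2 `^ (1 - Num.min z (Num.min e (1 - e))).
Proof.
have maxE (a b : R) : Num.max (2 `^ a) (2 `^ b) = 2 `^ (Num.max a b).
  have two_ge1 : 1 <= 2 :> R by rewrite ler1n.
  by case: (leP a b) => [ab|/ltW ba]; [rewrite max_r | rewrite max_l];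
    rewrite ?ler_powR.
rewrite !maxE !oppr_min !addr_maxr opprB addrCA subrr addr0.
by congr (_ `^ _); rewrite [RHS]maxC [Num.max (1 - e) e]maxC -maxA.
Qed.

Theorem schatten_commutator_bound p r :
  (0 < d)%N -> (1 <= p)%E -> (1 <= r)%E ->
  commutator_bounds d p p r
    (Num.max (2 `^ recip p) (Num.max (2 `^ (1 - recip p)) (2 `^ (1 - recip r))) : R).
Proof.
move=> d_gt0 p1 r1 X Y; rewrite maxr_powR2.
have /andP[p_ge0 p_le1] := recip_itv p1; have /andP[r_ge0 _] := recip_itv r1.
apply: schatten_commutator_le => //.
- by rewrite !le_min r_ge0 p_ge0 subr_ge0 p_le1.
- by rewrite ge_min lexx.
- by rewrite !ge_min lexx orbT.
- by rewrite !ge_min lexx !orbT.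
Qed.

(** * Singular values of explicit matrices and the lower bounds *)

Lemma char_poly_conj (P A : 'M[R[i]]_d) :
  P \in unitmx -> char_poly (invmx P *m A *m P) = char_poly A.
Proof.
move=> Pu; rewrite /char_poly /char_poly_mx !map_mxM.
have XE : ('X%:M : 'M[{poly R[i]}]_d) =
    map_mx polyC (invmx P) *m 'X%:M *m map_mx polyC P.
  by rewrite scalar_mxC -mulmxA -map_mxM mulVmx // map_mx1 mulmx1.
rewrite {1}XE -mulmxBl -mulmxBr !det_mulmx mulrAC -det_mulmx -map_mxM mulVmx //.
by rewrite map_mx1 det1 mul1r.
Qed.

(** Both lists are the roots, with multiplicity, of the characteristic polynomial of [X^t* *m X]. *)
Lemma perm_spectral_diag_gram X (w : 'rV[R[i]]_d) : X^t* *m X = diag_mx w ->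
  perm_eq [seq spectral_diag (X^t* *m X) 0 i | i : 'I_d] [seq w 0 i | i : 'I_d].
Proof.
move=> XXw; apply: prod_XsubC_eq; rewrite !big_image /=.
have diagE (v : 'rV[R[i]]_d) :
    char_poly (diag_mx v) = \prod_i ('X - (v 0 i)%:P).
  rewrite char_poly_trig ?diag_mx_is_trig //.
  by apply: eq_bigr => i _; rewrite mxE eqxx.
rewrite -!diagE -XXw [in RHS](orthomx_spectralP (gram_normalmx X)).
by rewrite char_poly_conj // unitarymx_unit // spectral_unitarymx.
Qed.

(** The singular values are c, repeated #|A| times, and 0; every norm in the lower bounds is an
    instance. *)
Lemma schatten_multiple_partial_isometry p X (c : R) (A : {set 'I_d}) :
  (1 <= p)%E -> 0 <= c -> (0 < #|A|)%N ->
  X^t* *m X = diag_mx (\row_i (c ^+ 2 *+ (i \in A))%:C) ->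
  schatten p X = c * #|A|%:R `^ recip p.
Proof.
move=> p1 c_ge0 A_gt0 XX.
have perm_sv : perm_eq [seq singular_value X i | i : 'I_d]
    [seq c *+ (i \in A) | i : 'I_d].
  pose f (z : R[i]) := Num.sqrt (complex.Re z).
  have -> : [seq singular_value X i | i : 'I_d] =
      map f [seq spectral_diag (X^t* *m X) 0 i | i : 'I_d] by rewrite -map_comp.
  have -> : [seq c *+ (i \in A) | i : 'I_d] =
      map f [seq (\row_i (c ^+ 2 *+ (i \in A))%:C) 0 i | i : 'I_d].
    rewrite -map_comp; apply: eq_map => i /=; rewrite mxE /f.
    by case: (i \in A); rewrite ?sqrtr0 //= sqrtr_sqr ger0_norm.
  exact/perm_map/perm_spectral_diag_gram.
case: p p1 => [a| |//] p1; last first.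
  rewrite recip_infty powRr0 mulr1.
  have [i0 i0A] : exists i, i \in A by apply/set0Pn; rewrite -card_gt0.
  have d_gt0 : (0 < d)%N by apply: leq_ltn_trans (ltn_ord i0).
  have mem_sv x : (x \in [seq singular_value X i | i : 'I_d]) =
    (x \in [seq c *+ (i \in A) | i : 'I_d]) by exact: perm_mem.
  apply/le_anti/andP; split.
    have [i ->] := schatten_infty_attained X d_gt0.
    have : singular_value X i \in [seq singular_value X i | i : 'I_d].
      by rewrite map_f ?mem_enum.
    by rewrite mem_sv => /mapP[j _ ->]; case: (j \in A).
  have : c \in [seq singular_value X i | i : 'I_d].
    by rewrite mem_sv; apply/mapP; exists i0; rewrite ?mem_enum ?i0A.
  by move=> /mapP[i _ ->]; exact: schatten_infty_ge.
have a1 : 1 <= a by rewrite lee_fin in p1.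
have a_gt0 : 0 < a by exact: lt_le_trans ltr01 a1.
have a_neq0 : a != 0 by rewrite gt_eqF.
rewrite recip_fin // schatten_fin.
have -> : \sum_i singular_value X i `^ a = c `^ a * #|A|%:R.
  have : \sum_(x <- [seq singular_value X i | i : 'I_d]) x `^ a =
    \sum_(x <- [seq c *+ (i \in A) | i : 'I_d]) x `^ a by exact: perm_big.
  rewrite !big_image /= => ->.
  rewrite (bigID (mem A)) /= [X in _ + X]big1 ?addr0 => [|i /negPf->].
    under eq_bigr => i -> do rewrite mulr1n.
    by rewrite sumr_const mulr_natr.
  by rewrite mulr0n powR0.
by rewrite powRM ?powR_ge0 // -powRrM mulfV // powRr1.
Qed.

(** One commutator per term: [E01, E10] = D, of p-norm 2^(1/p); [D, E01] = 2 E01, divided by the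
    p-norm of D; [E10, D] = 2 E10, divided by the r-norm 2^(1/r) of D. *)
Theorem commutator_bounds_ge p r (C : R) : (1 < d)%N -> (1 <= p)%E -> (1 <= r)%E ->
  commutator_bounds d p p r C ->
  Num.max (2 `^ recip p) (Num.max (2 `^ (1 - recip p)) (2 `^ (1 - recip r))) <= C.
Proof.
move=> d_gt1 p1 r1 HC.
pose i0 : 'I_d := Ordinal (ltnW d_gt1); pose i1 : 'I_d := Ordinal d_gt1.
have i01 : i0 != i1 by [].
pose E01 : 'M[R[i]]_d := delta_mx i0 i1; pose E10 : 'M[R[i]]_d := delta_mx i1 i0.
pose D : 'M[R[i]]_d := delta_mx i0 i0 - delta_mx i1 i1.
have delta_adj i j : (delta_mx i j : 'M[R[i]]_d)^t* = delta_mx j i.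
  by rewrite trmx_delta map_delta_mx.
have delta_diag i : delta_mx i i = diag_mx (\row_k ((k == i)%:R)%:C) :> 'M[R[i]]_d.
  apply/matrixP => k l; rewrite !mxE rmorph_nat.
  have [->|kl] := eqVneq k l; first by rewrite andbb mulr1n.
  rewrite mulr0n; have [<-|//] := eqVneq k i.
  by rewrite eq_sym (negPf kl).
have norm_E i j q (c : R) : (1 <= q)%E -> 0 <= c ->
    schatten q (c%:C *: delta_mx i j : 'M[R[i]]_d) = c.
  move=> q1 c_ge0.
  rewrite (@schatten_multiple_partial_isometry q _ c [set j]) ?cards1 //.
    by rewrite powR1 mulr1.
  have -> : (c%:C *: delta_mx i j : 'M[R[i]]_d)^t* = c%:C *: delta_mx j i.
    rewrite -(delta_adj i j); apply/matrixP => k l; rewrite !mxE rmorphM.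
    by congr (_ * _); exact: conjc_real.
  rewrite -scalemxAl -scalemxAr scalerA mul_delta_mx.
  rewrite delta_diag -linearZ; congr diag_mx; apply/rowP => k; rewrite !mxE.
  rewrite inE -!rmorphM; congr (_%:C).
  by rewrite mulr_natr expr2.
have norm_D q : (1 <= q)%E -> schatten q D = 2 `^ recip q.
  move=> q1; rewrite (@schatten_multiple_partial_isometry q _ 1 [set i0; i1]) //.
  - by rewrite cards2 i01 mul1r.
  - by rewrite cards2.
  rewrite /D adjmxB !delta_adj mulmxBl !mulmxBr !mul_delta_mx.
  rewrite !mul_delta_mx_0 // sub0r opprK subr0.
  rewrite !delta_diag -linearD; congr diag_mx; apply/rowP => k; rewrite !mxE !inE.
  rewrite -rmorphD; congr (_%:C); rewrite expr1n.
  have [->|] := eqVneq k i0; first by rewrite (negPf i01) addr0.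
  by rewrite add0r.
have norm1_E i j q : (1 <= q)%E -> schatten q (delta_mx i j : 'M[R[i]]_d) = 1.
  by move=> q1; rewrite -[delta_mx i j]scale1r norm_E.
have comm1 : E01 *m E10 - E10 *m E01 = D by rewrite !mul_delta_mx.
have comm2 : D *m E01 - E01 *m D = 2%:C *: E01.
  rewrite mulmxBl mulmxBr !mul_delta_mx !mul_delta_mx_0 1?eq_sym //.
  by rewrite subr0 sub0r opprK rmorph_nat scaler_nat.
have comm3 : E10 *m D - D *m E10 = 2%:C *: E10.
  rewrite mulmxBl mulmxBr !mul_delta_mx !mul_delta_mx_0 1?eq_sym //.
  by rewrite subr0 sub0r opprK rmorph_nat scaler_nat.
have two_powR (e : R) : C * 2 `^ e >= 2 -> 2 `^ (1 - e) <= C.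
  by rewrite powRB ?pnatr_eq0 ?implybT // powRr1 // ler_pdivrMr // powR_gt0.
rewrite !ge_max; apply/and3P; split.
- by have := HC E01 E10; rewrite comm1 norm_D // !norm1_E // !mulr1.
- apply: two_powR; have := HC D E01.
  by rewrite comm2 norm_E // norm_D // norm1_E // mulr1.
- apply: two_powR; have := HC E10 D.
  by rewrite comm3 norm_E // norm_D // norm1_E // mulr1.
Qed.

End SchattenNorm.

Theorem theorem2 (R : realType) (d : nat) (hd : (2 <= d)%N) (p r : \bar R)
    (hp1 : (1 <= p)%E) (hr1 : (1 <= r)%E) :
  is_commutator_constant d p p r
    (Num.max (2 `^ recip p) (Num.max (2 `^ (1 - recip p)) (2 `^ (1 - recip r)))).
Proof.
split; first exact: schatten_commutator_bound (ltnW hd) hp1 hr1.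
by move=> C; exact: commutator_bounds_ge.
Qed.
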